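(* For every integer $r\ge 2$ there is $C= C(r)> 0$ such that for every connected $n$-vertex graph $G$ it holds that $\mathcal{D}_r(G,\mathcal{T}_n)\ge \lfloor\kappa(G)/C\rfloor$.
   Context: Graphs are finite and simple; $\kappa(G)$ denotes the vertex connectivity of $G$. Spanning-tree discrepancy: for a connected $n$-vertex graph $G$, an $r$-colouring $f:E(G)\to[r]$ of its edges, and a spanning tree $T$ of $G$ (which has $n-1$ edges), put $D_f(T) := r\cdot\left(\max_{1\le i\le r}|f^{-1}(i)\cap E(T)| - \frac{n-1}{r}\right)$. The $r$-colour spanning-tree discrepancy of $G$ is $\mathcal{D}_r(G,\mathcal{T}_n) := \min_{f:E(G)\to[r]}\ \max_{T} D_f(T)$, where the maximum is over all spanning trees $T$ of $G$. *)

(* Defs.v *)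
From HB Require Import structures.
From mathcomp Require Import all_boot all_order all_algebra.
From mathcomp Require Import classical_sets reals.

Set Implicit Arguments.
Unset Strict Implicit.
Unset Printing Implicit Defensive.

Import Order.TTheory GRing.Theory Num.Theory.
Local Open Scope ring_scope.

Record sgraph (V : finType) := SGraph {
  adj : rel V;
  adj_sym : symmetric adj;
  adj_irr : irreflexive adj }.

Definition edges (V : finType) (G : sgraph V) : {set {set V}} :=
  [set A : {set V} | [exists x, exists y, adj G x y && (A == [set x; y])]].

Definition edge_of (V : finType) (G : sgraph V) :=
  {A : {set V} | A \in edges G}.

(* The subgraph of G induced on S is connected; this requires S nonempty. *)
Definition connected_on (V : finType) (G : sgraph V) (S : {set V}) : bool :=
  (0 < #|S|)%N &&
  [forall x in S, forall y in S,
     connect [rel u v | [&& u \in S, v \in S & adj G u v]] x y].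

Definition graph_connected (V : finType) (G : sgraph V) : bool :=
  connected_on G [set: V].

(* More than k vertices, and connected after deleting any fewer than k of them;
   in particular the complete graph on n vertices has connectivity n - 1. *)
Definition k_connected (V : finType) (G : sgraph V) (k : nat) : bool :=
  (k < #|V|)%N && [forall X : {set V}, (#|X| < k)%N ==> connected_on G (~: X)].

Definition vertex_connectivity (V : finType) (G : sgraph V) : nat :=
  \max_(k < #|V| | k_connected G k) k.

(* Cycles have length at least 3: an edge x y yields the ucycle [:: x; y]. *)
Definition acyclic (V : finType) (G : sgraph V) : Prop :=
  forall c : seq V, ucycle (adj G) c -> (size c < 3)%N.

Definition spanning_tree (V : finType) (G T : sgraph V) : Prop :=
  [/\ subrel (adj T) (adj G), graph_connected T & acyclic T].

Definition colour_count (V : finType) (G T : sgraph V) (r : nat)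
    (f : {ffun edge_of G -> 'I_r}) (i : 'I_r) : nat :=
  #|[set a : edge_of G | (f a == i) && (val a \in edges T)]|.

Definition tree_discrepancy (R : realType) (V : finType) (G : sgraph V)
    (r : nat) (f : {ffun edge_of G -> 'I_r}) (T : sgraph V) : R :=
  r%:R * ((\max_(i < r) colour_count T f i)%:R - (#|V|%:R - 1) / r%:R).

(* For connected G and r > 0 both sets below are finite and nonempty, so the
   sup is a maximum and the inf a minimum. *)
Definition max_tree_discrepancy (R : realType) (V : finType) (G : sgraph V)
    (r : nat) (f : {ffun edge_of G -> 'I_r}) : R :=
  sup [set tree_discrepancy R f T | T in spanning_tree G]%classic.

Definition spanning_tree_discrepancy (R : realType) (V : finType)
    (G : sgraph V) (r : nat) : R :=
  inf [set max_tree_discrepancy R f | f in [set: {ffun edge_of G -> 'I_r}]]%classic.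

(* Main.v *)
Require Import Defs.
From mathcomp Require Import all_boot all_order all_algebra.
From mathcomp Require Import reals.
From mathcomp Require Import zify.

(* Fix a colouring and let rank_i be the number of edges of a spanning forest of
   colour i; a greedily grown spanning tree contains rank_i edges of colour i.
   Let W be the set of vertices seeing at least two colours, and call block a
   nontrivial component of some colour; no block is all of V, or that colour
   already has a monochromatic spanning tree.  A vertex of a block B outside W
   has all its neighbours in B, so unless B is contained in W, the set B /\ W is
   a separator and has at least k = kappa(G) elements.  So every block meets W
   at least twice, and by the minimum degree some block meets W in at least k/r
   vertices.  Counting the incidences between W and the blocks gives
   sum_i rank_i >= n - 1 + k/(2r), and one colour has at least the average rank,
   so C = 2r works. *)

Import Order.TTheory GRing.Theory Num.Theory.
Set Implicit Arguments.
Unset Strict Implicit.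

(** * Separators and minimum degree in a k-connected graph *)

Section Connectivity.
Variables (V : finType) (G : sgraph V) (k : nat).
Hypothesis Gk : k_connected G k.

(** Were S smaller than k, G - S would be connected; yet A minus S is closed under adjacency there
    and contains a but not b. *)
Lemma separator_card (A S : {set V}) (a b : V) :
  a \in A -> a \notin S -> b \notin A -> b \notin S ->
  (forall x y, x \in A -> x \notin S -> adj G x y -> (y \in A) || (y \in S)) ->
  k <= #|S|.
Proof.
move=> aA aS bA bS AS; case: leqP => // ltSk.
case/andP: Gk => _ /forallP/(_ S); rewrite ltSk => /andP[_].
move=> /forallP/(_ a); rewrite inE aS => /forallP/(_ b); rewrite inE bS /=.
set e := (X in connect X) => cab.
suff cl : closed e (mem (A :\: S)).
  by have := closed_connect cl cab; rewrite !inE aA aS (negPf bA) andbF.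
have se : symmetric e by move=> x y; rewrite /e /= andbCA adj_sym.
apply: (intro_closed (sym_connect_sym se)) => x y /= /and3P[].
rewrite !inE => xS yS xy /andP[_ xA].
by have := AS _ _ xA xS xy; rewrite (negPf yS) orbF.
Qed.

(** The neighbourhood of v separates v from any non-neighbour; if there is none, v has degree n - 1
    >= k. *)
Lemma min_degree (v : V) : k <= #|[set y | adj G v y]|.
Proof.
case/andP: (Gk) => kn _.
case: (pickP [pred b | (b != v) && ~~ adj G v b]) => [b /= /andP[bv vb] | none].
  apply: (@separator_card [set v] _ v b); rewrite ?inE ?adj_irr //.
  by move=> x y /set1P->; rewrite !inE => _ ->; rewrite orbT.
rewrite -ltnS; apply: leq_trans kn _.
rewrite -cardsT (cardsD1 v) inE add1n ltnS.
apply: subset_leq_card; apply/subsetP => y; rewrite !inE andbT => yv.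
by have := none y; rewrite /= yv => /negbFE.
Qed.

End Connectivity.

Local Notation root := fingraph.root.

(** * Counting incidences between colour components and vertices seeing several colours *)

Section Ranks.
Variables (V I : finType) (G : sgraph V) (e : I -> rel V).
Hypothesis e_sym : forall i, symmetric (e i).
Hypothesis e_adj : forall x y, adj G x y = [exists i, e i x y].

(* The number of edges of a spanning forest of r: every vertex other than a root
   contributes its edge towards the root. *)
Definition rank_of (r : rel V) := #|[set x | root r x != x]|.

Definition sees i x := [exists y, e i x y].
Definition mixed := [set x | 1 < #|[set i | sees i x]|].
(** A component with a single vertex is allowed here; the nontrivial ones are those with
    [sees i v]. *)
Definition block i v := [set x | connect (e i) v x].

Let csym i : connect_sym (e i). Proof. exact: sym_connect_sym. Qed.

Lemma sees_connect i x y : connect (e i) x y -> x != y -> sees i x.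
Proof.
case/connectP=> [[|z p]] /=; first by move=> _ -> /eqP.
by case/andP=> xz _ _ _; apply/existsP; exists z.
Qed.

Lemma sees_block i x y : sees i x -> connect (e i) x y -> sees i y.
Proof.
move=> sx xy; case: (eqVneq x y) => [<- // | nxy].
by apply: (@sees_connect i y x); rewrite 1?csym // eq_sym.
Qed.

Lemma mixed_block (k : nat) i x :
  k_connected G k -> (exists y, ~~ connect (e i) x y) -> sees i x ->
  (block i x \subset mixed) || (k <= #|block i x :&: mixed|).
Proof.
move=> Gk [b xb] sx; case: (boolP (_ \subset _)) => //= /subsetPn[a].
rewrite inE => xa anW.
apply: (separator_card Gk (A := block i x) (a := a) (b := b));
  rewrite ?inE ?xa ?(negPf xb) //=; first by rewrite inE in anW.
move=> y z; rewrite !inE => xy; rewrite xy /= -leqNgt => /card_le1_eqP W1 yz.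
move: yz; rewrite e_adj => /existsP[j yz].
have sj : sees j y by apply/existsP; exists z.
have := W1 j i; rewrite !inE sj (sees_block sx xy) => /(_ isT isT) ji.
by rewrite (connect_trans xy) // connect1 // ji.
Qed.

(** Each component is indexed by its root, and [sees i v] discards the trivial ones. *)
Lemma card_block_mixed_sum i :
  #|[set x | sees i x & x \in mixed]| =
  \sum_(v | sees i v && (root (e i) v == v)) #|block i v :&: mixed|.
Proof.
rewrite -sum1_card (partition_big (root (e i))
  [pred v | sees i v && (root (e i) v == v)]) /=; last first.
  move=> x; rewrite inE => /andP[sx _].
  by rewrite (sees_block sx (connect_root _ _)) root_root //=.
apply: eq_bigr => v /andP[sv /eqP rv]; rewrite -sum1_card.
apply: eq_bigl => x; rewrite !inE.
have -> : connect (e i) v x = (root (e i) x == v).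
  by rewrite -{2}rv (root_connect (@csym i)) csym.
case: (eqVneq (root (e i) x) v) => [xv|]; rewrite ?andbT ?andbF //.
rewrite (sees_block sv) // csym -xv; exact: connect_root.
Qed.

(** Every non-root sees colour i; the other vertices seeing it are roots, one for each block. *)
Lemma rank_sees i :
  #|[set x | sees i x]| =
  rank_of (e i) + #|[set v | sees i v & root (e i) v == v]|.
Proof.
rewrite -(cardsID [set x | root (e i) x != x]); congr (_ + _).
  apply: eq_card => x; rewrite !inE; case: eqVneq => //= rx.
    by rewrite andbF.
  by rewrite (sees_connect (connect_root _ _)) // eq_sym.
by apply: eq_card => x; rewrite !inE negbK andbC.
Qed.

(** Let m count the blocks and a the pairs of a vertex of W and a colour it sees. The ranks sum to n
    - |W| + a - m, while a >= 2|W| and a >= 2m - 2 + w, where w is the number of vertices of W in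
    one large block. Hence twice the sum is at least 2(n - 1) + w, and w is at least k divided by
    the number of colours. *)
Lemma rank_sum_lower (k : nat) :
  1 < k -> k_connected G k ->
  (forall i x, exists y, ~~ connect (e i) x y) ->
  2 * #|I| * #|V|.-1 + k <= 2 * #|I| * \sum_i rank_of (e i).
Proof.
move=> k1 Gk nc.
have kV : k < #|V| by case/andP: Gk.
have [v _] : exists v : V, v \in V by apply/card_gt0P; apply: leq_ltn_trans kV.
have seen x : 0 < #|[set i | sees i x]|.
  have /card_gt0P[y] : 0 < #|[set y | adj G x y]|.
    by apply: leq_trans (min_degree Gk x); lia.
  rewrite inE e_adj => /existsP[i xy].
  by apply/card_gt0P; exists i; rewrite inE; apply/existsP; exists y.
pose a i := #|[set x | sees i x & x \in mixed]|.
pose m i := #|[set v | sees i v & root (e i) v == v]|.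
have mE i : m i = \sum_(v | sees i v && (root (e i) v == v)) 1.
  by rewrite /m -sum1_card; apply: eq_bigl => x; rewrite inE.
(* A block inside [mixed] contributes both ends of an edge; any other contributes at least k > 1
   vertices. *)
have blk2 i x : sees i x -> 2 <= #|block i x :&: mixed|.
  move=> sx; case/orP: (mixed_block Gk (nc i x) sx) => [sub|]; last by lia.
  rewrite (setIidPl sub); case/existsP: (sx) => y xy.
  have nxy : x != y.
    apply/eqP => E; have : adj G x y by rewrite e_adj; apply/existsP; exists i.
    by rewrite E adj_irr.
  rewrite -[2]/(true.+1) -nxy -cards2; apply: subset_leq_card; apply/subsetP => z.
  by case/set2P=> ->; rewrite inE ?connect0 ?connect1.
have am i : 2 * m i <= a i.
  rewrite /a card_block_mixed_sum mE big_distrr /=.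
  by apply: leq_sum => x /andP[sx _]; apply: blk2.
(* A vertex of degree >= k has k/|I| of its neighbours in a single block. *)
have [i0 [i0v big0]] : exists i, sees i v /\ k <= #|I| * #|block i v :&: mixed|.
  have : exists i, k <= #|I| * #|block i v :\ v|.
    apply/existsP; apply: contraLR (min_degree Gk v).
    rewrite negb_exists -ltnNge => /forallP small.
    have [/eqP I0 | I0] := boolP (#|I| == 0).
      apply: leq_ltn_trans (_ : 0 < k); last by lia.
      rewrite leqn0 cards_eq0; apply/eqP/setP => y; rewrite !inE e_adj.
      by apply/existsP => -[i]; have := fintype0 i I0.
    rewrite -(ltn_pmul2l (_ : 0 < #|I|)) ?lt0n //.
    apply: leq_ltn_trans (_ : #|I| * \sum_i #|block i v :\ v| < _).
      rewrite leq_mul2l; apply/orP; right.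
      apply: leq_trans (_ : #|\bigcup_i (block i v :\ v)| <= _).
        apply: subset_leq_card; apply/subsetP => y; rewrite inE => vy.
        have yv : y != v by apply: contraTneq vy => ->; rewrite adj_irr.
        move: vy; rewrite e_adj => /existsP[i vy].
        by apply/bigcupP; exists i; rewrite // !inE yv connect1.
      elim/big_rec2: _ => [|i s A _ IH]; first by rewrite cards0.
      by rewrite (leq_trans (leq_card_setU _ _)) // leq_add2l.
    have -> : #|I| * k = \sum_(i : I) k by rewrite sum_nat_const.
    have -> : #|I| * \sum_i #|block i v :\ v| = \sum_i #|I| * #|block i v :\ v|.
      by rewrite big_distrr.
    have [i _] : exists i : I, i \in I by apply/card_gt0P; rewrite lt0n.
    rewrite (bigD1 i) // [X in _ < X](bigD1 i) //= -addSn leq_add //.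
      by rewrite ltnNge; apply: small.
    by apply: leq_sum => j _; apply: ltnW; rewrite ltnNge; apply: small.
  case=> i kB; exists i.
  have sv : sees i v.
    have /card_gt0P[y] : 0 < #|block i v :\ v| by nia.
    by rewrite !inE => /andP[yv vy]; apply: sees_connect vy _; rewrite eq_sym.
  (* Intersecting with [mixed] either loses nothing or leaves at least k vertices. *)
  split=> //; case/orP: (mixed_block Gk (nc i v) sv) => [sub|kW].
    rewrite (setIidPl sub); apply: leq_trans kB _.
    by rewrite leq_mul2l subset_leq_card ?orbT ?subD1set.
  have : 0 < #|I| by apply/card_gt0P; exists i.
  by nia.
(* In the bound [am] the large block now counts in full instead of as 2, whence the + 2 on the
   right. *)
have am0 : 2 * m i0 + #|block i0 v :&: mixed| <= a i0 + 2.
  pose u := root (e i0) v.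
  have uP : sees i0 u && (root (e i0) u == u).
    by rewrite (sees_block i0v (connect_root _ _)) root_root /=.
  have -> : block i0 v = block i0 u.
    apply/setP => x; rewrite !inE; apply: same_connect => //.
    exact: connect_root.
  rewrite /a card_block_mixed_sum mE (bigD1 u) // [in X in _ <= X](bigD1 u) //=.
  have : 2 * \sum_(j | sees i0 j && (root (e i0) j == j) && (j != u)) 1 <=
    \sum_(j | sees i0 j && (root (e i0) j == j) && (j != u))
      #|block i0 j :&: mixed|.
    rewrite big_distrr; apply: leq_sum => x /andP[/andP[sx _] _].
    exact: blk2.
  by lia.
have sumam : 2 * \sum_i m i + #|block i0 v :&: mixed| <= \sum_i a i + 2.
  rewrite (bigD1 i0) // [in X in _ <= X](bigD1 i0) //=.
  have : 2 * \sum_(i | i != i0) m i <= \sum_(i | i != i0) a i.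
    by rewrite big_distrr; apply: leq_sum => i _; apply: am.
  by lia.
have aE : \sum_i a i = \sum_(x in mixed) #|[set i | sees i x]|.
  rewrite (eq_bigr (fun i => \sum_(x in mixed) (sees i x : nat))); last first.
    move=> i _; rewrite /a -sum1_card [RHS]big_mkcond /= big_mkcond /=.
    by apply: eq_bigr => x _; rewrite inE; do 2 case: ifP => //; case: sees.
  rewrite exchange_big; apply: eq_bigr => x _.
  rewrite -sum1_card [RHS]big_mkcond; apply: eq_bigr => i _.
  by rewrite inE; case: sees.
have a2 : 2 * #|mixed| <= \sum_i a i.
  rewrite aE mulnC -sum_nat_const; apply: leq_sum => x.
  by rewrite inE.
(* Vertices outside [mixed] see exactly one colour, by [seen]; those in [mixed] account for the sum
   of [a]. *)
have sE : \sum_i #|[set x | sees i x]| + #|mixed| = \sum_i a i + #|V|.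
  have -> : \sum_i #|[set x | sees i x]| = \sum_x #|[set i | sees i x]|.
    rewrite (eq_bigr (fun i => \sum_x (sees i x : nat))); last first.
      move=> i _; rewrite -sum1_card big_mkcond.
      by apply: eq_bigr => x _; rewrite inE; case: sees.
    rewrite exchange_big; apply: eq_bigr => x _.
    rewrite -sum1_card [RHS]big_mkcond; apply: eq_bigr => i _.
    by rewrite inE; case: sees.
  rewrite (bigID (mem mixed)) -aE -(cardsC mixed) -addnA; congr (_ + _).
  rewrite addnC; congr (_ + _); rewrite -sum1_card.
  rewrite [RHS](eq_bigl (fun x => x \notin mixed)); last by move=> x; rewrite inE.
  apply: eq_bigr => x; rewrite /= inE -leqNgt => d1.
  by apply/eqP; rewrite eqn_leq d1 seen.
move: sE; rewrite (eq_bigr _ (fun i _ => rank_sees i)) big_split => sE.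
have {}sE : \sum_i rank_of (e i) + \sum_i m i + #|mixed| = \sum_i a i + #|V|.
  exact: sE.
have : 2 * #|V|.-1 + #|block i0 v :&: mixed| <= 2 * \sum_i rank_of (e i).
  lia.
by rewrite -(leq_pmul2l (_ : 0 < #|I|)); [nia | apply/card_gt0P; exists i0].
Qed.

End Ranks.

(** * Spanning trees given by a parent function with a decreasing height *)

Section ParentTree.
Variables (V : finType) (G : sgraph V).
Variables (rt : V) (p : V -> V) (h : V -> nat).
Hypothesis h_parent : forall x, x != rt -> h (p x) < h x.
Hypothesis p_adj : forall x, x != rt -> adj G x (p x).

Definition parent_adj : rel V :=
  [rel x y | (x != rt) && (p x == y) || (y != rt) && (p y == x)].

Fact parent_adj_sym : symmetric parent_adj.
Proof. by move=> x y; rewrite /parent_adj /= orbC. Qed.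

Fact parent_adj_irr : irreflexive parent_adj.
Proof.
move=> x; rewrite /parent_adj /= orbb; apply/negP => /andP[/h_parent + /eqP E].
by rewrite E ltnn.
Qed.

Definition parent_tree := SGraph parent_adj_sym parent_adj_irr.

Lemma parent_tree_spanning : spanning_tree G parent_tree.
Proof.
split.
- move=> x y /= /orP[] /andP[/p_adj + /eqP <-] //.
  by rewrite adj_sym.
- apply/andP; split; first by apply/card_gt0P; exists rt.
  set e := [rel u v | _].
  have to_root x : connect e x rt.
    move: {2}(h x).+1 (ltnSn (h x)) => n; elim: n x => // n IH x hx.
    case: (eqVneq x rt) => [-> // | xr].
    have px := h_parent xr.
    apply: connect_trans (IH (p x) _); last by lia.
    by apply: connect1; rewrite /e /= !inE /parent_adj /= xr eqxx.
  have se : symmetric e by move=> x y; rewrite /e /= !inE parent_adj_sym.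
  apply/forall_inP => x _; apply/forall_inP => y _.
  by apply: connect_trans (to_root x) _; rewrite (sym_connect_sym se).
(* At a vertex of maximal height both cycle neighbours are its parent. *)
- move=> c; rewrite leqNgt; case: c => [|x0 c] //; set s := x0 :: c => cyc.
  apply/negP => s3.
  have [x xs xmax] : exists2 x, x \in s & forall y, y \in s -> h y <= h x.
    have x0s : x0 \in s by exact: mem_head.
    by case: (arg_maxnP (P := mem s) h x0s) => x xs xm; exists x.
  (* Once the cycle is rotated to start at x, its second and last vertices are both [p x], but they
     are distinct in a cycle of length at least 3. *)
  case: (rot_to xs) => i s' rs.
  have up y : y \in s -> parent_adj x y -> y = p x.
    move=> ys /orP[] /andP[nr /eqP E] //.
    by have := h_parent nr; have := xmax y ys; rewrite E; lia.
  have mems y : y \in s' -> y \in s.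
    by move=> ys'; rewrite -(mem_rot i) rs inE ys' orbT.
  move: cyc s3; rewrite -(rot_ucycle i) -(size_rot i) rs /ucycle.
  case: s' mems {rs} => [|y [|z s']] // mems.
  rewrite /= rcons_path => /andP[/and3P[xy _ /= lx] /and4P[_ ynz _ _]] _.
  have yE := up y (mems y (mem_head _ _)) xy.
  have ly : last z s' \in z :: s' by exact: mem_last.
  have lE : last z s' = p x.
    apply: up; first by apply: mems; rewrite inE ly orbT.
    by case/andP: lx => _; rewrite parent_adj_sym.
  by move: ynz; rewrite yE -lE ly.
Qed.

End ParentTree.

(** * Greedy growth of a spanning tree containing many [e]-edges *)

Section GreedyTree.
Variables (V : finType) (G : sgraph V) (e : rel V).
Hypothesis Gc : graph_connected G.
Hypothesis e_sym : symmetric e.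
Hypothesis e_adj : subrel e (adj G).

Lemma boundary_edge (S : {set V}) a b : a \in S -> b \notin S ->
  exists s y, [/\ s \in S, y \notin S & adj G s y].
Proof.
move=> aS bS; case/andP: Gc => _ /forallP/(_ a); rewrite inE => /forallP/(_ b).
rewrite inE; set d := (X in connect X) => ab.
have [/existsP[s /existsP[y /and3P[]]] | no] :=
    boolP [exists s, exists y, [&& s \in S, y \notin S & adj G s y]].
  by exists s, y.
have sd : symmetric d by move=> x y; rewrite /d /= !inE adj_sym.
suff cl : closed d (mem S).
  by have := closed_connect cl ab; rewrite aS (negPf bS).
apply: (intro_closed (sym_connect_sym sd)) => x y /= /and3P[_ _ xy] xS.
apply: contraR no => yS; apply/existsP; exists x; apply/existsP; exists y.
by rewrite xS yS.
Qed.

(* An e-edge leaving S is used whenever there is one, so a step that is not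
   along e enters an e-component not met before. *)
Lemma greedy_step (S : {set V}) a b : a \in S -> b \notin S ->
  exists s y, [/\ s \in S, y \notin S, adj G s y &
    e y s || (root e y \notin [set root e x | x in S])].
Proof.
move=> aS bS.
have [/existsP[s /existsP[y /and3P[sS yS sy]]] | no] :=
    boolP [exists s, exists y, [&& s \in S, y \notin S & e s y]].
  by exists s, y; split=> //; rewrite ?e_adj // e_sym sy.
have [s [y [sS yS sy]]] := boundary_edge aS bS; exists s, y; split=> //.
apply/orP; right; apply/imsetP => -[x xS /eqP].
rewrite (root_connect (sym_connect_sym e_sym)) => yx.
suff cl : closed e (mem S).
  by have := closed_connect cl yx; rewrite xS (negPf yS).
apply: (intro_closed (sym_connect_sym e_sym)) => u v /= uv uS.
apply: contraR no => vS; apply/existsP; exists u; apply/existsP; exists v.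
by rewrite uS vS.
Qed.

(** The invariant of the growth is that |S| is at most the number of [e]-edges used plus the number
    of [e]-components met. *)
Lemma greedy_parent : exists (rt : V) (p : V -> V) (h : V -> nat),
  [/\ forall x, x != rt -> h (p x) < h x, forall x, x != rt -> adj G x (p x)
    & rank_of e <= #|[set x | x != rt & e x (p x)]|].
Proof.
have [/card_gt0P[rt _] _] := andP Gc; exists rt.
have grow n : n < #|V| -> exists (S : {set V}) (p : V -> V) (h : V -> nat),
  [/\ rt \in S, #|S| = n.+1, forall x, x \in S -> h x < n.+1,
    forall x, x \in S -> x != rt -> [/\ p x \in S, h (p x) < h x & adj G x (p x)]
    & #|S| <= #|[set x in S | x != rt & e x (p x)]| + #|[set root e x | x in S]|].
  elim: n => [|n IH] nV.
    exists [set rt], id, (fun=> 0); split=> //; rewrite ?inE ?cards1 //.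
      by move=> x /set1P->; rewrite eqxx.
    by rewrite imset_set1 cards1 leq_addl.
  have [S [p [h [rtS cS hS pS cnt]]]] := IH (ltnW nV).
  have [b bS] : exists b, b \notin S.
    apply/existsP; apply: contraLR nV; rewrite negb_exists => /forallP all.
    rewrite -leqNgt -cardsT -cS subset_leq_card //; apply/subsetP => x _.
    by have := all x; rewrite negbK.
  have [s [y [sS yS sy step]]] := greedy_step rtS bS.
  have nyS x : x \in S -> (x == y) = false.
    by move=> xS; apply: contraNF yS => /eqP <-.
  (* The height is the insertion time, so the new vertex lies above all earlier ones. *)
  exists (y |: S), (fun x => if x == y then s else p x),
    (fun x => if x == y then n.+1 else h x); split.
  - by rewrite inE rtS orbT.
  - by rewrite cardsU1 yS cS.
  - by move=> x /setU1P[-> | xS]; rewrite ?eqxx // (nyS _ xS) ltnW // ltnS hS.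
  - move=> x /setU1P[-> _ | xS xr].
      by rewrite eqxx (nyS _ sS) inE sS orbT hS // adj_sym.
    have [pxS hp ap] := pS x xS xr.
    by rewrite (nyS _ xS) (nyS _ pxS) inE pxS orbT.
  - rewrite cardsU1 yS imsetU1.
    set F := [set x in S | _] in cnt; set F' := [set x in _ | _].
    set Q := imset _ _ in cnt *.
    have sub : F \subset F'.
      apply/subsetP => x; rewrite !inE => /andP[xS].
      by rewrite (nyS _ xS) xS orbT.
    (* An [e]-edge raises the edge count by one; otherwise a new component raises the other term. *)
    case/orP: step => [ys | yQ]; last first.
      rewrite cardsU1 yQ addnCA leq_add2l (leq_trans cnt) // leq_add2r.
      exact: subset_leq_card.
    have : #|y |: F| <= #|F'|.
      apply: subset_leq_card; rewrite subUset sub andbT sub1set !inE !eqxx ys.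
      by rewrite eq_sym (nyS _ rtS).
    have : #|Q| <= #|root e y |: Q| by rewrite subset_leq_card ?subsetUr.
    by rewrite (cardsU1 y F) [y \in F]inE (negPf yS) /=; lia.
have V0 : 0 < #|V| by apply/card_gt0P; exists rt.
have [|S [p [h [rtS cS hS pS cnt]]]] := grow #|V|.-1; first by rewrite prednK.
have ST : S = [set: V].
  by apply/eqP; rewrite eqEcard subsetT cardsT cS prednK //=.
have xS x : x \in S by rewrite ST inE.
exists p, h; split=> [x xr | x xr |]; try by have [] := pS x (xS x) xr.
(* At S = V the components met number at most n minus the rank, so the invariant leaves at least the
   rank for the edges. *)
have := cardsC [set x | root e x != x].
have : #|[set root e x | x in S]| <= #|~: [set x | root e x != x]|.
  apply: subset_leq_card; apply/subsetP => _ /imsetP[x _ ->].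
  by rewrite !inE negbK root_root //; apply: sym_connect_sym.
have -> : [set x | x != rt & e x (p x)] = [set x in S | x != rt & e x (p x)].
  by apply/setP => x; rewrite !inE ST inE.
by rewrite /rank_of; move: cnt; rewrite {1}ST cardsT; lia.
Qed.

End GreedyTree.

(** * Colour classes and spanning trees with a frequent colour *)

Section Colouring.
Variables (V : finType) (G : sgraph V) (r : nat) (f : {ffun edge_of G -> 'I_r}).
Hypothesis Gc : graph_connected G.

(** Quantifying over edges avoids carrying a proof that the pair x, y is an edge. *)
Definition colour_adj (i : 'I_r) : rel V :=
  [rel x y | [exists a : edge_of G, (f a == i) && (val a == [set x; y])]].

Lemma colour_adj_sym i : symmetric (colour_adj i).
Proof. by move=> x y; rewrite /colour_adj /= setUC. Qed.

Lemma adj_colour x y : adj G x y = [exists i, colour_adj i x y].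
Proof.
apply/idP/existsP => [xy | [i /existsP[a /andP[_ /eqP aE]]]].
  have xyE : [set x; y] \in edges G.
    rewrite inE; apply/existsP; exists x; apply/existsP; exists y.
    by rewrite xy eqxx.
  exists (f (Sub [set x; y] xyE)); apply/existsP.
  by exists (Sub [set x; y] xyE); rewrite eqxx SubK eqxx.
have := valP a; rewrite inE => /existsP[u /existsP[v /andP[uv /eqP]]].
rewrite aE => E.
have : (u \in [set x; y]) && (v \in [set x; y]) by rewrite E !inE !eqxx orbT.
have : (x \in [set u; v]) && (y \in [set u; v]) by rewrite -E !inE !eqxx orbT.
have uv' : u != v by apply: contraTneq uv => ->; rewrite adj_irr.
(* Of the four ways to place x and y among u and v, the two with x = y contradict u != v. *)
rewrite !inE => /andP[/pred2P[]-> /pred2P[]->] //; rewrite ?orbb.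
- by case/andP=> _ /eqP vu; rewrite vu eqxx in uv'.
- by rewrite adj_sym.
- by case/andP=> /eqP vu; rewrite vu eqxx in uv'.
Qed.

Section Counts.
Variables (rt : V) (p : V -> V) (h : V -> nat).
Hypothesis h_parent : forall x, x != rt -> h (p x) < h x.

(** The map from x to {x, p x} is injective off the root: a coincidence would make two vertices each
    other's parent, against [h_parent]. *)
Lemma parent_tree_count i :
  #|[set x | x != rt & colour_adj i x (p x)]|
    <= colour_count (parent_tree h_parent) f i.
Proof.
rewrite /colour_count -(card_imset _ val_inj).
rewrite -(card_in_imset (f := fun x => [set x; p x])).
  apply: subset_leq_card; apply/subsetP => _ /imsetP[x + ->].
  rewrite inE => /andP[xr /existsP[a /andP[ai /eqP aE]]].
  rewrite -aE; apply: imset_f; rewrite inE ai aE inE.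
  apply/existsP; exists x; apply/existsP; exists (p x).
  by rewrite /= /parent_adj /= xr !eqxx.
move=> x y; rewrite !inE => /andP[xr _] /andP[yr _] E.
have : x \in [set y; p y] by rewrite -E set21.
have : y \in [set x; p x] by rewrite E set21.
case/set2P=> // yE /set2P[] // xE.
have := h_parent xr; have := h_parent yr; rewrite -xE -yE; lia.
Qed.

(** Each of the n - 1 parent edges has some colour; averaging over colours then settles small
    connectivity. *)
Lemma parent_tree_total : (forall x, x != rt -> adj G x (p x)) ->
  #|V|.-1 <= \sum_i colour_count (parent_tree h_parent) f i.
Proof.
move=> padj.
apply: (@leq_trans (\sum_i #|[set x | x != rt & colour_adj i x (p x)]|)); last first.
  by apply: leq_sum => i _; apply: parent_tree_count.
have -> : #|V|.-1 = #|[set: V] :\ rt| by rewrite cardsDS ?cards1 ?cardsT ?subn1.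
apply: leq_trans (_ : #|\bigcup_i [set x | x != rt & colour_adj i x (p x)]| <= _).
  apply: subset_leq_card; apply/subsetP => x; rewrite !inE andbT => xr.
  have := padj x xr; rewrite adj_colour => /existsP[i xi].
  by apply/bigcupP; exists i; rewrite // inE xr.
elim/big_rec2: _ => [|i s A _ IH]; first by rewrite cards0.
by rewrite (leq_trans (leq_card_setU _ _)) // leq_add2l.
Qed.

End Counts.

Lemma colour_greedy_tree i : exists T, [/\ spanning_tree G T,
  rank_of (colour_adj i) <= colour_count T f i &
  #|V|.-1 <= \sum_j colour_count T f j].
Proof.
have sub : subrel (colour_adj i) (adj G).
  by move=> x y xy; rewrite adj_colour; apply/existsP; exists i.
have [rt [p [h [hp pa le]]]] := greedy_parent Gc (@colour_adj_sym i) sub.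
exists (parent_tree hp); split; first exact: parent_tree_spanning.
  exact: leq_trans le (parent_tree_count _ _).
exact: parent_tree_total.
Qed.

Lemma connected_rank (e : rel V) x0 : symmetric e ->
  (forall y, connect e x0 y) -> rank_of e = #|V|.-1.
Proof.
move=> e_sym e_conn; have cs := sym_connect_sym e_sym.
have rE y : root e y = root e x0.
  by apply/eqP; rewrite root_connect // cs.
rewrite /rank_of -(cardsC1 (root e x0)); apply: eq_card => y.
by rewrite !inE rE eq_sym.
Qed.

Lemma leq_sum_max (F : 'I_r -> nat) : \sum_i F i <= r * \max_i F i.
Proof.
rewrite -[X in X * _]card_ord -sum_nat_const; apply: leq_sum => i _.
exact: leq_bigmax.
Qed.

Lemma average_tree : 0 < r -> exists T, spanning_tree G T /\
  #|V|.-1 <= r * \max_i colour_count T f i.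
Proof.
move=> r0; have [T [sT _ le]] := colour_greedy_tree (Ordinal r0).
by exists T; split=> //; apply: leq_trans le (leq_sum_max _).
Qed.

Lemma heavy_tree (k : nat) : 1 < r -> 1 < k -> k_connected G k ->
  exists T, spanning_tree G T /\
    2 * r * #|V|.-1 + k <= 2 * r * (r * \max_i colour_count T f i).
Proof.
move=> r2 k2 Gk; have kV : k < #|V| by case/andP: Gk.
suff [i rk] : exists i, 2 * r * #|V|.-1 + k <= 2 * r * (r * rank_of (colour_adj i)).
  have [T [sT le _]] := colour_greedy_tree i.
  exists T; split=> //; apply: leq_trans rk _; rewrite !leq_mul2l.
  by rewrite (leq_trans le) ?orbT //; apply: leq_bigmax.
have [/existsP[i /existsP[x /forallP con]] | disc] :=
    boolP [exists i, exists x, forall y, connect (colour_adj i) x y].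
  (* A connected colour has rank n - 1, and k <= n - 1 <= 2r(r - 1)(n - 1) since r >= 2. *)
  exists i; rewrite (connected_rank (@colour_adj_sym i) con).
  have : k <= #|V|.-1 by lia.
  by move: #|V|.-1 => n; nia.
have nc i x : exists y, ~~ connect (colour_adj i) x y.
  apply/existsP; apply: contraR disc; rewrite negb_exists => /forallP all.
  apply/existsP; exists i; apply/existsP; exists x; apply/forallP => y.
  by have := all y; rewrite negbK.
have := rank_sum_lower colour_adj_sym adj_colour k2 Gk nc.
rewrite card_ord => sum_rank.
have r0 : 0 < #|'I_r| by rewrite card_ord; lia.
have [i iE] := @bigop.eq_bigmax _ (fun i => rank_of (colour_adj i)) r0.
exists i; rewrite -iE; apply: leq_trans sum_rank _.
by rewrite leq_mul2l leq_sum_max orbT.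
Qed.

End Colouring.

(** Positivity disposes of the default value 0 of the maximum. *)
Lemma vertex_connectivity_attained (V : finType) (G : sgraph V) :
  0 < vertex_connectivity G -> k_connected G (vertex_connectivity G).
Proof.
rewrite /vertex_connectivity.
by elim/big_ind: _ => // x y; rewrite /maxn; case: ifP.
Qed.

Local Open Scope ring_scope.

(** * From one good tree per colouring to the real infimum of suprema *)

Section Discrepancy.
Variables (R : realType) (V : finType) (G : sgraph V) (r : nat).
Hypothesis r_gt0 : (0 < r)%N.

Lemma tree_discrepancyE (f : {ffun edge_of G -> 'I_r}) (T : sgraph V) :
  tree_discrepancy R f T =
  (r * \max_i colour_count T f i)%:R - (#|V|%:R - 1).
Proof.
by rewrite /tree_discrepancy mulrBr natrM mulrCA mulfV ?mulr1 ?pnatr_eq0 -?lt0n.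
Qed.

Lemma tree_discrepancy_le_max (f : {ffun edge_of G -> 'I_r}) (T : sgraph V) :
  spanning_tree G T -> tree_discrepancy R f T <= max_tree_discrepancy R f.
Proof.
move=> sT; apply: ub_le_sup; last by exists T.
(* The supremum needs a bounded set: no colour count exceeds the number of edges. *)
exists ((r * #|{: edge_of G}|)%:R - (#|V|%:R - 1)) => _ [S _ <-].
rewrite tree_discrepancyE lerD2r ler_nat leq_mul2l; apply/orP; right.
by apply/bigmax_leqP => i _; rewrite max_card.
Qed.

Lemma discrepancy_lower (b : R) :
  (forall f : {ffun edge_of G -> 'I_r}, exists T, spanning_tree G T /\
    b + (#|V|%:R - 1) <= (r * \max_i colour_count T f i)%:R) ->
  b <= spanning_tree_discrepancy R G r.
Proof.
move=> bT; apply: lb_le_inf.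
  (* The infimum needs a nonempty set; a constant colouring exists because r > 0. *)
  by exists (max_tree_discrepancy R [ffun _ : edge_of G => Ordinal r_gt0]); eexists.
move=> _ [f _ <-]; have [T [sT le]] := bT f.
by apply: le_trans (tree_discrepancy_le_max f sT); rewrite tree_discrepancyE lerBrDr.
Qed.

End Discrepancy.

Unset Implicit Arguments.
Set Strict Implicit.

Theorem corollary1p4 (R : realType) (r : nat) :
  (2 <= r)%N ->
  exists C : R, 0 < C /\
    forall (V : finType) (G : sgraph V), graph_connected G ->
      (Num.floor ((vertex_connectivity G)%:R / C))%:~R
        <= spanning_tree_discrepancy R G r.
Proof.
move=> r2; have r0 : (0 < r)%N by apply: leq_trans r2.
have C0 : 0 < (2 * r)%:R :> R by rewrite ltr0n muln_gt0.
exists (2 * r)%:R; split=> // V G Gc; apply: discrepancy_lower => // f.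
set k := vertex_connectivity G.
have V0 : (0 < #|V|)%N by case/andP: Gc; rewrite cardsT.
have VE : #|V|%:R - 1 = #|V|.-1%:R :> R by rewrite -{1}(prednK V0) mulrSr addrK.
have [k1 | k1] := ltnP 1 k.
  have [T [sT le]] :=
    heavy_tree f Gc r2 k1 (vertex_connectivity_attained (ltnW k1)).
  (* After dropping the floor, multiplication by 2r turns the goal into the bound of
     [heavy_tree]. *)
  exists T; split=> //; apply: (@le_trans _ _ (k%:R / (2 * r)%:R + (#|V|%:R - 1))).
    by rewrite lerD2r; apply: Num.Theory.floor_le.
  rewrite VE -(ler_pM2l C0) mulrDr mulrCA mulfV ?gt_eqF // mulr1.
  by rewrite -!natrM -natrD ler_nat addnC.
have [T [sT le]] := average_tree f Gc r0; exists T; split=> //.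
(* Here k <= 1 < 2r, so the floor vanishes and the averaging bound suffices. *)
rewrite (_ : Num.floor _ = 0); first by rewrite add0r VE ler_nat.
apply: floor_def; rewrite add0r divr_ge0 ?ler0n //=.
by rewrite ltr_pdivrMr // mul1r ltr_nat; lia.
Qed.
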